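(* Let $x = (x_1,\dots,x_{2k})$ be a nondecreasing position of the game Exact $k$-Nim on $2k$ piles, $\mathrm{Nim}^{=}_{2k,k}$, i.e. $x_1 \le x_2 \le \cdots \le x_{2k}$. Then: (i) $x$ is a $\mathcal{P}$-position if and only if more than half of its smallest coordinates are equal, that is, $x_1 = \cdots = x_k = x_{k+1}$. (ii) $x$ is a $1$-position if and only if $x_1 = \cdots = x_{k-\ell} = 2c$ and $x_{k-\ell+1} = \cdots = x_{k+\ell+1} = 2c+1$ for some integer $c \in \mathbb{Z}_{\ge}$ and some $\ell \in \{0,1,\ldots,k-1\}$.
   Context: $\mathbb{Z}_{\ge}$ denotes the set of nonnegative integers. For integers $1 \le k \le n$, Exact $k$-Nim, denoted $\mathrm{Nim}^{=}_{n,k}$, is the following impartial game. A position is a vector $x=(x_1,\dots,x_n) \in \mathbb{Z}_{\ge}^n$, where $x_i$ is the number of tokens in pile $i$. A move $x \to x'$ consists of choosing exactly $k$ piles and removing an arbitrary positive number of tokens from each of them. The game terminates when there are fewer than $k$ nonempty piles; the player who makes the last move wins. The Sprague-Grundy function is defined recursively by $\mathcal{G}(x) = \operatorname{mex}\{\mathcal{G}(y) \mid x \to y\}$, where $\operatorname{mex}(S)$ is the smallest nonnegative integer not in $S$ (and $\operatorname{mex}(\emptyset)=0$). A position $x$ is called a $t$-position if $\mathcal{G}(x)=t$; $0$-positions are also called $\mathcal{P}$-positions. *)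

(* Defs.v *)
From mathcomp Require Import all_boot.

Set Implicit Arguments.
Unset Strict Implicit.
Unset Printing Implicit Defensive.

Definition position (n : nat) := {ffun 'I_n -> nat}.

Definition move (n k : nat) (x y : position n) : bool :=
  [exists S : {set 'I_n}, (#|S| == k) &&
     [forall i, if i \in S then y i < x i else y i == x i]].

(* The positions coordinatewise at most x, each listed once. *)
Definition below (n : nat) (x : position n) : seq (position n) :=
  [seq [ffun i => val (f i)] | f : {dffun forall i : 'I_n, 'I_(x i).+1}].

Definition options (n k : nat) (x : position n) : seq (position n) :=
  [seq y <- below x | move k x y].

Lemma mex_subproof (s : seq nat) : exists v, v \notin s.
Proof.
exists (sumn s).+1; apply/negP => s_v.
have le_s a (t : seq nat) : a \in t -> a <= sumn t.
  elim: t => //= b t IHt; rewrite inE => /predU1P[-> | /IHt le_a].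
    exact: leq_addr.
  exact: leq_trans le_a (leq_addl _ _).
by have := le_s _ _ s_v; rewrite ltnn.
Qed.

Definition mex (s : seq nat) : nat := ex_minn (mex_subproof s).

Fixpoint grundy_rec (n k d : nat) (x : position n) : nat :=
  if d is d'.+1 then mex [seq grundy_rec k d' y | y <- options k x] else 0.

(* For k > 0 every move decreases the total number of tokens, which is thus a
   sufficient recursion depth: see grundyE for the defining equation. For
   k = 0 the move relation is reflexive and the value is meaningless. *)
Definition grundy (n k : nat) (x : position n) : nat :=
  grundy_rec k (\sum_i x i) x.

Definition t_position (n k t : nat) (x : position n) : Prop := grundy k x = t.

Definition P_position (n k : nat) (x : position n) : Prop := t_position k 0 x.

Definition nondecreasing (n : nat) (x : position n) : Prop :=
  forall i j : 'I_n, i <= j -> x i <= x j.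

Lemma mem_options (n k : nat) (x y : position n) :
  (y \in options k x) = move k x y.
Proof.
rewrite mem_filter; case mv: (move k x y) => //=.
have le_yx i : y i < (x i).+1.
  have /existsP[S /andP[_ /forallP/(_ i)]] := mv.
  by case: ifP => _ => [/ltnW | /eqP->].
apply/imageP.
exists (finfun (fun i => Ordinal (le_yx i)) :
         {dffun forall i : 'I_n, 'I_(x i).+1}) => //.
by apply/ffunP=> i; rewrite !ffunE.
Qed.

Lemma move_sum (n k : nat) (x y : position n) :
  0 < k -> move k x y -> \sum_i y i < \sum_i x i.
Proof.
move=> k_gt0 /existsP[S /andP[/eqP cardS /forallP mv]].
have /card_gt0P[i0 Si0] : 0 < #|S| by rewrite cardS.
rewrite (bigD1 i0) //= [X in _ < X](bigD1 i0) //= -addSn leq_add //.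
  by have := mv i0; rewrite Si0.
by apply: leq_sum => i _; have := mv i; case: ifP => _ => [/ltnW | /eqP->].
Qed.

Lemma grundyE (n k : nat) (x : position n) :
  0 < k -> grundy k x = mex [seq grundy k y | y <- options k x].
Proof.
move=> k_gt0.
have stuck (z : position n) : \sum_i z i <= 0 -> options k z = [::].
  move=> z0; apply/nilP; rewrite /nilp -leqn0 leqNgt -has_predT.
  apply/hasPn => y; rewrite mem_options => /(move_sum k_gt0).
  by move=> /leq_trans/(_ z0).
have mex0 : mex [::] = 0.
  by rewrite /mex; case: ex_minnP => m _ /(_ 0 isT); case: m.
have rec_eq d e (z : position n) : \sum_i z i <= d -> \sum_i z i <= e ->
    grundy_rec k d z = grundy_rec k e z.
  elim: d e z => [|d IHd] [|e] z //= le_d le_e; try by rewrite stuck.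
  congr mex; apply/eq_in_map => y; rewrite mem_options => /(move_sum k_gt0) lt.
  by apply: IHd; rewrite -ltnS; [exact: leq_trans le_d | exact: leq_trans le_e].
rewrite /grundy (rec_eq _ (\sum_i x i).+1) //=; congr mex; apply/eq_in_map => y.
by rewrite mem_options => /(move_sum k_gt0)/ltnW lt; apply: rec_eq.
Qed.

(* Main.v *)
Require Import Defs.
From mathcomp Require Import all_boot zify.

Set Implicit Arguments.
Unset Strict Implicit.
Unset Printing Implicit Defensive.

(** The two families are first described without sorting the piles.  Write
    [N v] for the number of piles of size at most [v].  The claims become:
    - the value is 0 iff [N m > k] for a lower bound [m] of all the piles;
    - the value is 1 iff [N (2c) <= k] and [N (2c) + N (2c+1) > 2k] for some
      lower bound [2c] of all the piles.
    For a nondecreasing position the piles of size at most [v] are the first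
    [N v] ones ([nondecreasing_leqE]), so these conditions are those of the
    theorem, with [l = k - N (2c)].

    The unsorted claims follow from the usual description of the positions of
    a given value ([grundy_eqP]): no move joins two of them, they have no
    smaller value, and from any other position without smaller value a move
    leads to one of them.

    What makes the game on [2k] piles tractable is that exactly [k] piles are
    touched and [k] are not.  Independence: a move that goes below the old
    lower bound leaves at most [k] piles at the new low sizes, which is too
    few.  From value 0 every move does so, since it must touch one of the more
    than [k] minimal piles.  From value 1, a move that respects the bound [2c]
    cannot touch the piles of size [2c], hence must lower so many piles of
    size [2c+1] to [2c] that [N (2c)] exceeds [k].  Absorption: towards value
    0, lower to the minimum [k] piles that are above it; towards value 1,
    arrive at exactly [k] piles of size [2c] and at least one of size
    [2c+1]. *)

(** * The mex recursion *)

Lemma mexP (s : seq nat) (t : nat) :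
  mex s = t <-> t \notin s /\ forall u, u < t -> u \in s.
Proof.
rewrite /mex; case: ex_minnP => m m_s min_m; split=> [<- | [t_s below_t]].
  split=> // u u_m; apply: contraLR u_m => u_s; rewrite -leqNgt; exact: min_m.
have le_mt := min_m _ t_s; apply/eqP; rewrite eqn_leq le_mt leqNgt /=.
by apply/negP => /below_t; rewrite (negPf m_s).
Qed.

Section GrundyValues.

Variables (n k : nat).
Hypothesis k_gt0 : 0 < k.
Implicit Types x y : position n.

Lemma grundy_move_neq x y : move k x y -> grundy k y <> grundy k x.
Proof.
move=> mv eq_g; have /mexP[+ _] := esym (grundyE x k_gt0).
by case/negP; rewrite -eq_g map_f // mem_options.
Qed.

Lemma grundy_move_lt x u :
  u < grundy k x -> exists2 y, move k x y & grundy k y = u.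
Proof.
have /mexP[_ all_u] := esym (grundyE x k_gt0).
move=> /all_u /mapP[y]; rewrite mem_options => mv ->.
by exists y.
Qed.

(** The hypotheses mention smaller values only through [grundy] itself, so
    that the case [t = 1] can be built on the case [t = 0].  A position of [K]
    cannot have value above [t], as it would then have an option of value [t],
    in [K] by induction. *)
Lemma grundy_eqP (t : nat) (K : position n -> Prop) :
    (forall x y, K x -> move k x y -> ~ K y) ->
    (forall x, K x -> t <= grundy k x) ->
    (forall x, t <= grundy k x -> K x \/ exists2 y, move k x y & K y) ->
  forall x, grundy k x = t <-> K x.
Proof.
move=> indep ge_t absorb x.
have [d] := ubnP (\sum_i x i); elim: d x => // d IHd x le_d.
have IH y : move k x y -> (grundy k y = t <-> K y).
  by move=> /(move_sum k_gt0) lt_yx; apply: IHd; apply: leq_trans lt_yx _.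
split=> [gx | Kx].
  have [//|[y mv Ky]] := absorb x (eq_leq (esym gx)).
  by have /(IH y mv) gy := Ky; case: (grundy_move_neq mv); rewrite gx.
have := ge_t x Kx; rewrite leq_eqVlt => /predU1P[-> // | lt_t].
have [y mv /(IH y mv) Ky] := grundy_move_lt lt_t.
by case: (indep x y Kx mv).
Qed.

End GrundyValues.

(** * Moves and low piles *)

Lemma exists_set_between (T : finType) (X Y : {set T}) (m : nat) :
    X \subset Y -> #|X| <= m <= #|Y| ->
  exists Z : {set T}, [/\ X \subset Z, Z \subset Y & #|Z| = m].
Proof.
move=> sXY; elim: m => [|m IHm] /andP[leX leY].
  by exists X; split=> //; apply/eqP; rewrite -leqn0.
move: leX; rewrite leq_eqVlt => /predU1P[eqX | ltX]; first by exists X.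
have [|Z [sXZ sZY cZ]] := IHm; first by rewrite -ltnS ltX ltnW.
have /subsetPn[i Yi Z'i] : ~~ (Y \subset Z).
  by apply/negP => /subset_leq_card; rewrite cZ leqNgt leY.
exists (i |: Z); split; last by rewrite cardsU1 Z'i cZ.
  exact: subset_trans sXZ (subsetUr _ _).
by rewrite subUset sub1set Yi.
Qed.

Lemma moveP (n k : nat) (x y : position n) :
  reflect (exists S : {set 'I_n},
             [/\ #|S| = k, forall i, i \in S -> y i < x i
               & forall i, i \notin S -> y i = x i])
          (move k x y).
Proof.
apply: (iffP existsP) => [[S /andP[/eqP cS /forallP mv]] | [S [cS inS outS]]].
  exists S; split=> // i Si; have := mv i; rewrite ?Si // (negPf Si).
  by move/eqP.
exists S; rewrite cS eqxx; apply/forallP => i.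
by case: ifPn => Si; [exact: inS | apply/eqP; exact: outS].
Qed.

Definition lower (n : nat) (S : {set 'I_n}) (f : 'I_n -> nat) (x : position n) :
  position n := [ffun i => if i \in S then f i else x i].

Lemma move_lower (n k : nat) (S : {set 'I_n}) (f : 'I_n -> nat)
    (x : position n) :
  #|S| = k -> (forall i, i \in S -> f i < x i) -> move k x (lower S f x).
Proof.
move=> cS lt_fx; apply/moveP; exists S; split=> // i Si; rewrite ffunE ?Si.
  exact: lt_fx.
by rewrite (negPf Si).
Qed.

Definition low (n : nat) (x : position n) (v : nat) : {set 'I_n} :=
  [set i | x i <= v].

Lemma low_move_sub (n : nat) (x y : position n) (S : {set 'I_n}) (v m : nat) :
    (forall i, i \notin S -> y i = x i) -> (forall i, m <= x i) -> v < m ->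
  low y v \subset S.
Proof.
move=> outS ge_m lt_vm; apply/subsetP => i; rewrite inE.
by apply: contraTT => /outS ->; rewrite -ltnNge (leq_trans lt_vm).
Qed.

Lemma exists_min_pile (n : nat) (x : position n) :
  0 < n -> exists i0, forall i, x i0 <= x i.
Proof.
case: n x => // n x _; case: (@arg_minnP _ ord0 predT x) => // i0 _ min_i0.
by exists i0 => i; apply: min_i0.
Qed.

Lemma card_low_leq (n : nat) (x : position n) (v : nat) : #|low x v| <= n.
Proof. by rewrite -[X in _ <= X]card_ord max_card. Qed.

Section TwiceK.

Variable k : nat.
Hypothesis k_gt0 : 0 < k.
Implicit Types x y : position (2 * k).

Let two_k_gt0 : 0 < 2 * k. Proof. by rewrite muln_gt0. Qed.

Lemma card_add_setC (S : {set 'I_(2 * k)}) : #|S| + #|~: S| = 2 * k.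
Proof. by rewrite cardsC card_ord. Qed.

(** Used with [S] the touched set and [L] a set of low piles: a move cannot
    avoid touching low piles if there are more than [k] of them. *)
Lemma card_meet (S L : {set 'I_(2 * k)}) : #|S| + #|L| <= #|S :&: L| + 2 * k.
Proof.
by rewrite -cardsUI addnC leq_add2l (leq_trans (max_card _)) // card_ord.
Qed.

(** * Positions of value 0 *)

Definition zero_class x : Prop :=
  exists m, (forall i, m <= x i) /\ k < #|low x m|.

Lemma zero_class_indep x y : zero_class x -> move k x y -> ~ zero_class y.
Proof.
move=> [m [ge_m gt_k]] /moveP[S [cS inS outS]] [m' [ge_m' gt_k']].
(* the k untouched piles cannot contain all the minimal ones *)
have /card_gt0P[i] : 0 < #|S :&: low x m| by have := card_meet S (low x m); lia.
rewrite !inE => /andP[/inS lt_i le_i].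
have lt_m'm : m' < m.
  by apply: leq_ltn_trans (ge_m' i) _; apply: leq_trans lt_i le_i.
have := subset_leq_card (low_move_sub outS ge_m lt_m'm).
by rewrite cS leqNgt gt_k'.
Qed.

Lemma zero_class_absorb x :
  zero_class x \/ exists2 y, move k x y & zero_class y.
Proof.
have [i0 min_i0] := exists_min_pile x two_k_gt0.
have [le_k | gt_k] := leqP #|low x (x i0)| k; last by left; exists (x i0).
have [| |S [_ sS cS]] := @exists_set_between _ set0 (~: low x (x i0)) k.
- exact: sub0set.
- by rewrite cards0; have := card_add_setC (low x (x i0)); lia.
have Si i : i \in S -> x i0 < x i.
  by move/(subsetP sS); rewrite !inE ltnNge.
right; exists (lower S (fun=> x i0) x); first exact: move_lower.
exists (x i0); split=> [i|]; first by rewrite ffunE; case: ifP.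
have S'i0 : i0 \notin S by apply/negP => /Si; rewrite ltnn.
have <- : #|i0 |: S| = k.+1 by rewrite cardsU1 S'i0 cS.
apply: subset_leq_card; apply/subsetP => i; rewrite !inE ffunE.
by case: ifP => //; rewrite orbF => _ /eqP->.
Qed.

Lemma grundy0P x : grundy k x = 0 <-> zero_class x.
Proof.
apply: grundy_eqP => // [|z _]; first exact: zero_class_indep.
exact: zero_class_absorb.
Qed.

(** * Positions of value 1 *)

Definition one_class x : Prop :=
  exists c, [/\ forall i, 2 * c <= x i, #|low x (2 * c)| <= k
              & 2 * k < #|low x (2 * c)| + #|low x (2 * c).+1|].

(** The number of minimal piles separates the classes: it is at most [k] in
    this one, and more than [k] for value 0. *)
Lemma one_class_not_zero x : one_class x -> ~ zero_class x.
Proof.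
move=> [c [ge_c le_k gt_2k]] [m [ge_m gt_k]].
have /card_gt0P[i] : 0 < #|low x (2 * c)|.
  by have := card_low_leq x (2 * c).+1; lia.
rewrite inE => le_i.
have : low x m \subset low x (2 * c).
  apply/subsetP => j; rewrite !inE => le_j.
  exact: leq_trans le_j (leq_trans (ge_m i) le_i).
by move/subset_leq_card; lia.
Qed.

Lemma one_class_indep x y : one_class x -> move k x y -> ~ one_class y.
Proof.
move=> [c [ge_c le_k gt_2k]] /moveP[S [cS inS outS]].
move=> [c' [ge_c' le_k' gt_2k']].
have le_yx i : y i <= x i.
  by have [/inS/ltnW | /outS->] := boolP (i \in S).
have /card_gt0P[i0] : 0 < #|low x (2 * c)|.
  by have := card_low_leq x (2 * c).+1; lia.
rewrite inE => le_i0.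
have le_c'c : c' <= c by have := ge_c' i0; have := le_yx i0; lia.
move: le_c'c; rewrite leq_eqVlt => /predU1P[eq_c | lt_c].
- (* The minimal piles are out of reach, so the k touched piles comprise at
     least N (2c+1) - k piles of size 2c+1, which all drop to 2c. *)
  subst c'.
  have disj : [disjoint low x (2 * c) & S :&: low x (2 * c).+1].
    rewrite disjoint_subset; apply/subsetP => i; rewrite !inE => le_i.
    apply/negP => /andP[/inS lt_i _].
    by have := ge_c' i; lia.
  have sub : low x (2 * c) :|: S :&: low x (2 * c).+1 \subset low y (2 * c).
    apply/subsetP => i; rewrite !inE => /orP[le_i | /andP[/inS lt_i le_i]].
      exact: leq_trans (le_yx i) le_i.
    by rewrite -ltnS (leq_trans lt_i).
  have := subset_leq_card sub.
  have [_] := leq_card_setU (low x (2 * c)) (S :&: low x (2 * c).+1).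
  rewrite disj => /eqP->.
  by have := card_meet S (low x (2 * c).+1); lia.
(* Below the old bound only the k touched piles count. *)
have le v : v < 2 * c -> #|low y v| <= k.
  by move=> /(low_move_sub outS ge_c)/subset_leq_card; rewrite cS.
have := le (2 * c'); have := le (2 * c').+1; lia.
Qed.

(** If the minimum is odd, [2c+1], lower any [k] piles to [2c], sparing one
    minimal pile. *)
Lemma one_class_absorb_odd x i0 (c : nat) :
    (forall i, x i0 <= x i) -> x i0 = (2 * c).+1 ->
  exists2 y, move k x y & one_class y.
Proof.
move=> min_i0 x_i0.
have [| |S [_ sS cS]] := @exists_set_between _ set0 (~: [set i0]) k.
- exact: sub0set.
- by rewrite cards0 cardsC1 card_ord; lia.
have S'i0 : i0 \notin S by apply/negP => /(subsetP sS); rewrite !inE eqxx.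
exists (lower S (fun=> 2 * c) x).
  by apply: move_lower => // i _; rewrite -x_i0.
have low0 : low (lower S (fun=> 2 * c) x) (2 * c) = S.
  apply/setP => i; rewrite !inE ffunE; case: ifP => _; first exact: leqnn.
  by apply/negbTE; rewrite -ltnNge -x_i0.
exists c; rewrite low0 cS; split=> // [i|].
  by rewrite ffunE; case: ifP => // _; have := min_i0 i; lia.
have <- : #|i0 |: S| + k = (2 * k).+1 by rewrite cardsU1 S'i0 cS; lia.
rewrite addnC leq_add2l; apply: subset_leq_card; apply/subsetP => i.
rewrite !inE ffunE; case: ifP => // _; rewrite orbF => /eqP->.
by rewrite x_i0.
Qed.

(** If the minimum is [2c], the touched set [S] avoids the minimal piles [A] and
    takes as few piles of size [2c+1] as possible; those must drop to [2c], and
    the failure of the condition for value 1 ensures that this makes at most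
    [k] piles of size [2c].  The other touched piles fill up the set [T] of
    piles of size [2c] to [k] elements, and the remainder of [S] stops at
    [2c+1]. *)
Lemma one_class_absorb_even x (c : nat) :
    (forall i, 2 * c <= x i) -> 0 < #|low x (2 * c)| <= k ->
    #|low x (2 * c)| + #|low x (2 * c).+1| <= 2 * k ->
  exists2 y, move k x y & one_class y.
Proof.
set A := low x (2 * c); set C := ~: low x (2 * c).+1.
move=> ge_c /andP[A_gt0 le_k] le_2k.
have cC := card_add_setC (low x (2 * c).+1); rewrite -/C in cC.
have sCA : C \subset ~: A.
  by apply/subsetP => i; rewrite !inE; apply: contra => /leq_trans->.
have [S [sSA cS few]] : exists S : {set 'I_(2 * k)},
    [/\ S \subset ~: A, #|S| = k & #|A| + #|S :\: C| <= k].
  have [le_kC | /ltnW le_Ck] := leqP k #|C|.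
    have [||S [_ sS cS]] := @exists_set_between _ set0 C k.
    - exact: sub0set.
    - by rewrite cards0.
    exists S; split=> //; first exact: subset_trans sS sCA.
    have /eqP -> : S :\: C == set0 by rewrite setD_eq0.
    by rewrite cards0 addn0.
  have [//||S [sCS sS cS]] := @exists_set_between _ C (~: A) k.
    by rewrite le_Ck; have := card_add_setC A; lia.
  exists S; split=> //.
  by have := cardsD S C; rewrite (setIidPr sCS) cS => ->; lia.
have disj : [disjoint A & S] by rewrite disjoint_sym disjoints_subset.
have cAS : #|A :|: S| = #|A| + k.
  by have [_] := leq_card_setU A S; rewrite disj cS => /eqP.
have [| |T [sT sTAS cT]] := @exists_set_between _ (A :|: S :\: C) (A :|: S) k.
- exact: setUS (subsetDl _ _).
- rewrite cAS leq_addl andbT (leq_trans _ few) //.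
  exact: (leq_of_leqif (leq_card_setU _ _)).
have S_notA i : i \in S -> 2 * c < x i.
  by move/(subsetP sSA); rewrite !inE ltnNge.
have ST i : i \in S -> i \notin T -> (2 * c).+1 < x i.
  move=> Si; apply: contraR; rewrite -leqNgt => le_i; apply: (subsetP sT).
  by rewrite !inE Si le_i orbT.
set f := fun i => if i \in T then 2 * c else (2 * c).+1.
exists (lower S f x).
  apply: move_lower => // i Si; rewrite /f.
  by case: ifPn => [_ | T'i]; [exact: S_notA | exact: ST].
have low0 : low (lower S f x) (2 * c) = T.
  apply/setP => i; rewrite !inE ffunE /f.
  case: ifPn => Si; first by case: ifP => _; rewrite ?leqnn ?ltnn.
  apply/idP/idP => [le_i | /(subsetP sTAS)].
    by apply: (subsetP sT); rewrite !inE le_i.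
  by rewrite !inE (negPf Si) orbF.
exists c; rewrite low0 cT; split=> // [i|].
  by rewrite ffunE /f; case: ifP => // _; case: ifP.
suff: #|A :|: S| <= #|low (lower S f x) (2 * c).+1| by rewrite cAS; lia.
apply: subset_leq_card; apply/subsetP => i; rewrite !inE ffunE /f.
by case: ifP => [_ _ | _]; [case: ifP | rewrite orbF => /leq_trans->].
Qed.

Lemma one_class_absorb x :
  ~ zero_class x -> one_class x \/ exists2 y, move k x y & one_class y.
Proof.
move=> not0; have [i0 min_i0] := exists_min_pile x two_k_gt0.
have := odd_double_half (x i0); rewrite -mul2n.
case: odd; rewrite ?add1n ?add0n => /esym x_i0.
  by right; apply: one_class_absorb_odd min_i0 x_i0.
rewrite x_i0 in min_i0; set c := _./2 in x_i0 min_i0.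
have le_k : #|low x (2 * c)| <= k.
  by rewrite leqNgt; apply/negP => gt_k; apply: not0; exists (2 * c).
have A_gt0 : 0 < #|low x (2 * c)|.
  by apply/card_gt0P; exists i0; rewrite inE x_i0.
have [le_2k | gt_2k] :=
    leqP (#|low x (2 * c)| + #|low x (2 * c).+1|) (2 * k).
  by right; apply: one_class_absorb_even le_2k => //; rewrite A_gt0.
by left; exists c.
Qed.

Lemma grundy1P x : grundy k x = 1 <-> one_class x.
Proof.
apply: grundy_eqP => // [|z /one_class_not_zero not0|z gt0].
- exact: one_class_indep.
- by rewrite lt0n; apply/eqP => /grundy0P.
- by apply: one_class_absorb => /grundy0P z0; rewrite z0 in gt0.
Qed.

End TwiceK.

(** * Nondecreasing positions *)

Lemma card_initial_segment (n m : nat) :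
  m <= n -> #|[set i : 'I_n | i < m]| = m.
Proof.
move=> le_mn; rewrite -sum1dep_card -(big_ord_widen n (fun=> 1) le_mn).
by rewrite sum1_card card_ord.
Qed.

(** The low piles form an initial segment of indices, which its length
    determines. *)
Lemma nondecreasing_leqE (n : nat) (x : position n) (v : nat) (i : 'I_n) :
  nondecreasing x -> (x i <= v) = (i < #|low x v|).
Proof.
move=> x_mono; have [le_v | gt_v] := leqP (x i) v; apply/esym.
  rewrite -[X in X <= _](card_initial_segment (ltn_ord i)) subset_leq_card //.
  apply/subsetP => j; rewrite !inE ltnS => le_ji.
  exact: leq_trans (x_mono _ _ le_ji) le_v.
apply/negbTE; rewrite -leqNgt.
rewrite -[X in _ <= X](card_initial_segment (ltnW (ltn_ord i))).
apply: subset_leq_card; apply/subsetP => j; rewrite !inE ltnNge => le_j.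
apply: contraL le_j => /x_mono le_ij.
by rewrite -ltnNge (leq_trans gt_v).
Qed.

Lemma nondecreasing_zero_class (k : nat) (x : position (2 * k)) :
    0 < k -> nondecreasing x ->
  zero_class x <-> forall i j : 'I_(2 * k), i <= k -> j <= k -> x i = x j.
Proof.
move=> k_gt0 x_mono; have lt0 : 0 < 2 * k by lia.
have lt_k : k < 2 * k by lia.
split=> [[m [ge_m gt_k]] | eq_x].
  have eq_m (i : 'I_(2 * k)) : i <= k -> x i = m.
    move=> le_i; apply/eqP; rewrite eqn_leq ge_m andbT nondecreasing_leqE //.
    exact: leq_ltn_trans le_i gt_k.
  by move=> i j /eq_m-> /eq_m->.
exists (x (Ordinal lt0)); split=> [i|]; first exact: x_mono.
by rewrite -[X in X < _]/(nat_of_ord (Ordinal lt_k)) -nondecreasing_leqE //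
           (eq_x _ (Ordinal lt0)).
Qed.

Lemma nondecreasing_one_class (k : nat) (x : position (2 * k)) :
    0 < k -> nondecreasing x ->
  one_class x <->
    exists c l : nat,
      l <= k - 1 /\
      (forall i : 'I_(2 * k), i < k - l -> x i = 2 * c) /\
      (forall i : 'I_(2 * k), k - l <= i <= k + l -> x i = 2 * c + 1).
Proof.
move=> k_gt0 x_mono.
split=> [[c [ge_c le_k gt_2k]] | [c [l [le_l [eq0 eq1]]]]].
  have le_2k := card_low_leq x (2 * c).+1.
  exists c, (k - #|low x (2 * c)|); split; first by lia.
  split=> i lt_i; have := ge_c i.
    have : x i <= 2 * c by rewrite nondecreasing_leqE //; lia.
    lia.
  have : x i <= (2 * c).+1 by rewrite nondecreasing_leqE //; lia.
  have : ~~ (x i <= 2 * c) by rewrite nondecreasing_leqE //; lia.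
  lia.
have lt0 : 0 < 2 * k by lia.
have lt1 : k - l < 2 * k by lia.
have lt2 : k + l < 2 * k by lia.
have lt3 : k - l - 1 < 2 * k by lia.
exists c.
(* The indices k-l-1, k-l and k+l delimit the two blocks. *)
have x0 : x (Ordinal lt0) = 2 * c by apply: eq0 => /=; lia.
have x1 : x (Ordinal lt1) = 2 * c + 1 by apply: eq1 => /=; lia.
have x2 : x (Ordinal lt2) = 2 * c + 1 by apply: eq1 => /=; lia.
have x3 : x (Ordinal lt3) = 2 * c by apply: eq0 => /=; lia.
have := nondecreasing_leqE (2 * c) (Ordinal lt1) x_mono.
have := nondecreasing_leqE (2 * c).+1 (Ordinal lt2) x_mono.
have := nondecreasing_leqE (2 * c) (Ordinal lt3) x_mono.
rewrite x1 x2 x3 /= => h3 h2 h1.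
split; [by move=> i; rewrite -x0; apply: x_mono | lia | lia].
Qed.

Theorem corollary1 (k : nat) (hk : 1 <= k) (x : position (2 * k))
    (hx : nondecreasing x) :
  (P_position k x <->
     forall i j : 'I_(2 * k), i <= k -> j <= k -> x i = x j)
  /\
  (t_position k 1 x <->
     exists c l : nat,
       l <= k - 1 /\
       (forall i : 'I_(2 * k), i < k - l -> x i = 2 * c) /\
       (forall i : 'I_(2 * k), k - l <= i <= k + l -> x i = 2 * c + 1)).
Proof.
split.
  exact: iff_trans (grundy0P hk x) (nondecreasing_zero_class hk hx).
exact: iff_trans (grundy1P hk x) (nondecreasing_one_class hk hx).
Qed.
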